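(* Let $f:\mathbb{R}^m\to\mathbb{R}$ be a convex $C^1$-function which has a minimizer, and let $x:[0,\infty)\to\mathbb{R}^m$, $t\mapsto x_t$, be a gradient flow of $f$. Then \[ \lim_{t\to\infty} t\cdot\Big(f(x_t)-\inf_{x\in\mathbb{R}^m} f(x)\Big)=0. \]
   Context: A gradient flow of a $C^1$-function $f$ is a differentiable curve $x:[0,\infty)\to\mathbb{R}^m$ satisfying $\dot x_t=-\nabla f(x_t)$ for all $t\ge 0$. *)

(* Defs.v *)
From mathcomp Require Import all_boot all_order all_algebra.
From mathcomp Require Import all_classical all_reals all_analysis.
Set Implicit Arguments.
Unset Strict Implicit.
Unset Printing Implicit Defensive.
Import Order.TTheory GRing.Theory Num.Theory.
Import numFieldNormedType.Exports.
Local Open Scope classical_set_scope.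
Local Open Scope ring_scope.

Definition gradient (R : realType) (m : nat) (f : 'rV[R]_m -> R)
    (p : 'rV[R]_m) : 'rV[R]_m :=
  \row_(j < m) 'D_(delta_mx 0 j) f p.

Definition C1_function (R : realType) (m : nat) (f : 'rV[R]_m -> R) : Prop :=
  (forall p, differentiable f p) /\ continuous (gradient f).

Definition has_minimizer (T : Type) (R : realType) (f : T -> R) : Prop :=
  exists p, forall q, f p <= f q.

(* [x] stands for a curve on [0, +oo[: its values at negative times are never
   used, so that the derivative at [t = 0] is the right derivative. *)
Definition has_derivative_ge0 (R : realType) (m : nat) (x : R -> 'rV[R]_m)
    (t : R) (v : 'rV[R]_m) : Prop :=
  h^-1 *: (x (t + h) - x t) @[h --> within [set h | 0 <= t + h] (0 : R)^']
    --> v.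

Definition gradient_flow (R : realType) (m : nat) (f : 'rV[R]_m -> R)
    (x : R -> 'rV[R]_m) : Prop :=
  forall t, 0 <= t -> has_derivative_ge0 x t (- gradient f (x t)).

(* Main.v *)
(* For a minimizer p of f, the squared distance |x_t - p|^2 has derivative
   -2 <grad f (x_t), x_t - p>, which is at most -2 (f (x_t) - f p) by convexity.
   As f (x_t) is nonincreasing, the mean value theorem gives
   2 (t - s) (f (x_t) - f p) <= |x_s - p|^2 - |x_t - p|^2 for 0 < s <= t.  With
   s = t / 2 the right-hand side tends to 0, because a nonincreasing
   nonnegative function converges at infinity.  The Euclidean distance is
   written as a sum of squares, the norm of 'rV[R]_m being the sup norm. *)
Require Import Defs.
From mathcomp Require Import all_boot all_order all_algebra.
From mathcomp Require Import all_classical all_reals all_analysis.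
From mathcomp Require Import ring lra.
Import Order.TTheory GRing.Theory Num.Theory.
Import numFieldNormedType.Exports.
Local Open Scope classical_set_scope.
Local Open Scope ring_scope.

(** For [0 < h < 1] the point [h *: (q - p) + p] is a convex combination of [q] and [p], so each
    difference quotient is at most [f q - f p]; the bound survives the limit from the right. *)
Lemma convex_derive_le (R : realType) (V : normedModType R) (f : V -> R)
    (p q : V) :
  convex_function [set: convex_lmodType V] f -> derivable f p (q - p) ->
  'D_(q - p) f p <= f q - f p.
Proof.
move=> f_convex f_der.
have cvgD : h^-1 *: (f (h *: (q - p) + p) - f p)
  @[h --> 0^'+] --> 'D_(q - p) f p.
  apply: cvg_trans; last exact: f_der.
  apply: cvg_app; apply: within_subset => h /=; exact: lt0r_neq0.
apply: (cvgr_to_le cvgD); near=> h.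
have h0 : 0 < h by near: h; exact: nbhs_right_gt.
have h1 : h < 1 by near: h; exact: nbhs_right_lt.
have := f_convex (Itv01 (ltW h0) (ltW h1)) q p (in_setT _) (in_setT _).
rewrite convRE /conv /= => f_le.
have -> : h *: (q - p) + p = h *: q + (1 - h) *: p.
  by rewrite scalerBr scalerBl scale1r addrAC -addrA.
rewrite /GRing.scale /= mulrC ler_pdivrMr // (le_trans (lerB f_le (lexx _))) //.
by rewrite /unstable.onem; lra.
Unshelve. all: by end_near. Qed.

Lemma is_derive_comp_curve (R : realType) (V : normedModType R) (f : V -> R)
    (x : R -> V) (t : R) (v : V) :
  differentiable f (x t) -> is_derive t 1 x v ->
  is_derive t 1 (f \o x) ('D_v f (x t)).
Proof.
move=> df [dx <-].
have /derivable1_diffP dx' := dx.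
have dfx : differentiable (f \o x) t by exact: differentiable_comp.
split; first exact/derivable1_diffP.
by rewrite !deriveE // diff_comp.
Qed.

(** The differential is linear, so it is determined by the partial derivatives that make up
    [gradient]. *)
Lemma derive_gradient (R : realType) (m : nat) (f : 'rV[R]_m -> R)
    (p v : 'rV[R]_m) :
  differentiable f p -> 'D_v f p = \sum_(j < m) v 0 j * gradient f p 0 j.
Proof.
move=> df; rewrite deriveE // [in LHS](row_sum_delta v) linear_sum /=.
by apply: eq_bigr => j _; rewrite linearZ /= mxE deriveE.
Qed.

(** At an interior time the constraint [0 <= t + h] holds as soon as [|h| < t], so the restricted
    limit is the two-sided one. *)
Lemma has_derivative_ge0_is_derive (R : realType) (m : nat)
    (x : R -> 'rV[R]_m) (t : R) (v : 'rV[R]_m) :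
  0 < t -> has_derivative_ge0 x t v -> is_derive t 1 x v.
Proof.
move=> t0 xv; suff xv' : h^-1 *: ((x \o shift t) (h *: 1) - x t)
    @[h --> 0^'] --> v.
  split; last exact: cvg_lim.
  by apply/cvg_ex; exists v.
have -> : (fun h : R => h^-1 *: ((x \o shift t) (h *: 1) - x t)) =
    fun h => h^-1 *: (x (t + h) - x t).
  by apply/funext => h /=; rewrite [h *: 1]mulr1 [h + t]addrC.
apply: cvg_trans xv; apply: cvg_app => A; rewrite /within /= => WA.
have th : \forall h \near (0 : R)^', 0 <= t + h.
  near=> h; have : `|h| < t by near: h; exact: dnbhs0_lt.
  by rewrite ltr_norml => /andP[+ _]; rewrite ltrNl; lra.
by apply: filterS2 th WA => h th; apply.
Unshelve. all: by end_near. Qed.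

Lemma is_derive_sqdist (R : realType) (m : nat) (x : R -> 'rV[R]_m)
    (p : 'rV[R]_m) (t : R) (v : 'rV[R]_m) :
  is_derive t 1 x v ->
  is_derive t 1 (fun s => \sum_(j < m) (x s 0 j - p 0 j) ^+ 2)
    (2 * \sum_(j < m) (x t 0 j - p 0 j) * v 0 j).
Proof.
move=> [dx xv].
have dxj j : is_derive t 1 (fun s => x s 0 j) (v 0 j).
  split; first exact: ((derivable_mxP _ _ _).1 dx 0 j).
  by rewrite -xv derive_mx // mxE.
(* Written with operations on functions, the sum can be differentiated by instance resolution. *)
have -> : (fun s => \sum_(j < m) (x s 0 j - p 0 j) ^+ 2) =
    \sum_(j < m) ((fun s => x s 0 j) - cst (p 0 j)) ^+ 2.
  by apply/funext => s; rewrite fct_sumE.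
apply: is_derive_eq; rewrite mulr_sumr; apply: eq_bigr => j _.
by rewrite /GRing.scale /= subr0 expr1 !fctE /=; ring.
Qed.

Lemma is_derive_MVT (R : realType) (f df : R -> R) (a b : R) :
  a <= b -> (forall t, a <= t <= b -> is_derive t 1 f (df t)) ->
  exists2 c, a <= c <= b & f b - f a = df c * (b - a).
Proof.
move=> ab f_df; have [||c] := @MVT_segment R f df a b ab.
- by move=> t; rewrite in_itv /= => /andP[/ltW ? /ltW ?]; apply: f_df; apply/andP.
- apply: derivable_within_continuous => t; rewrite in_itv /= => /f_df.
  by case.
by rewrite in_itv /= => cab fE; exists c.
Qed.

(* The hypotheses make [phi] nonincreasing and nonnegative, hence Cauchy at
   infinity; the last one with [s = t / 2] then bounds [t * g t]. *)
Lemma cvg_mul_decrement (R : realType) (phi g : R -> R) :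
  (forall t : R, 0 < t -> 0 <= phi t) ->
  (forall t : R, 0 < t -> 0 <= g t) ->
  (forall s t : R, 0 < s -> s <= t -> (t - s) * g t <= phi s - phi t) ->
  t * g t @[t --> +oo] --> 0.
Proof.
move=> phi_ge0 g_ge0 phi_dec.
pose E := [set phi t | t in [set t | 0 < t]].
have E_lb : has_lbound E by exists 0 => _ [t t0 <-]; exact: phi_ge0.
have E_inf : has_inf E by split=> //; exists (phi 1), 1 => //=; exact: ltr01.
apply/cvgr0Pnorm_le => e e0.
have e4 : 0 < e / 4 by rewrite divr_gt0.
(* From time [s] on, [phi] stays within [e / 4] of its infimum. *)
have [_ [s /= s0 <-] phis] := inf_adherent e4 E_inf.
near=> t.
have st : 2 * s <= t by near: t; apply: nbhs_pinfty_ge; rewrite num_real.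
have t0 : 0 < t by lra.
have t2 : 0 < t / 2 by lra.
have inft : inf E <= phi t by apply: ge_inf => //; exists t.
(* Here [phi (t / 2) <= phi s < inf E + e / 4] and [inf E <= phi t], whence
   [t / 2 * g t < e / 4]. *)
have := phi_dec s (t / 2) s0 ltac:(lra).
have : 0 <= (t / 2 - s) * g (t / 2) by rewrite mulr_ge0 ?g_ge0 //; lra.
have := phi_dec (t / 2) t t2 ltac:(lra).
rewrite ger0_norm; last by rewrite mulr_ge0 ?g_ge0 // ltW.
lra.
Unshelve. all: by end_near. Qed.

Lemma inf_range_minimizer (T : Type) (R : realType) (f : T -> R) (p : T) :
  (forall q, f p <= f q) -> inf (range f) = f p.
Proof.
move=> fp; apply/eqP; rewrite eq_le; apply/andP; split.
  by apply: ge_inf; [exists (f p) => _ [q _ <-] | exists p].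
by apply: lb_le_inf; [exists (f p), p | move=> _ [q _ <-]].
Qed.

Lemma gradient_flow_is_derive (R : realType) (m : nat) (f : 'rV[R]_m -> R)
    (x : R -> 'rV[R]_m) (t : R) :
  gradient_flow f x -> 0 < t -> is_derive t 1 x (- gradient f (x t)).
Proof.
move=> x_flow t0; apply: has_derivative_ge0_is_derive => //.
by apply: x_flow; exact: ltW.
Qed.

(** Along the flow, [f] has derivative minus the squared Euclidean norm of the gradient. *)
Lemma gradient_flow_nincr (R : realType) (m : nat) (f : 'rV[R]_m -> R)
    (x : R -> 'rV[R]_m) (s t : R) :
  (forall p, differentiable f p) -> gradient_flow f x -> 0 < s -> s <= t ->
  f (x t) <= f (x s).
Proof.
move=> f_diff x_flow s0 st.
have [|c _ fE] := @is_derive_MVT R (f \o x)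
    (fun c => 'D_(- gradient f (x c)) f (x c)) s t st.
  move=> c /andP[sc _]; apply: is_derive_comp_curve => //.
  by apply: gradient_flow_is_derive => //; exact: lt_le_trans s0 sc.
rewrite -subr_le0 [leLHS]fE mulr_le0_ge0 ?subr_ge0 //.
rewrite derive_gradient // sumr_le0 // => j _.
by rewrite mxE mulNr oppr_le0 -expr2 sqr_ge0.
Qed.

Lemma gradient_flow_sqdist (R : realType) (m : nat) (f : 'rV[R]_m -> R)
    (x : R -> 'rV[R]_m) (p : 'rV[R]_m) (s t : R) :
  convex_function [set: convex_lmodType 'rV[R]_m] f ->
  (forall q, differentiable f q) -> gradient_flow f x ->
  (forall q, f p <= f q) -> 0 < s -> s <= t ->
  (t - s) * (2 * (f (x t) - f p)) <=
    \sum_(j < m) (x s 0 j - p 0 j) ^+ 2 - \sum_(j < m) (x t 0 j - p 0 j) ^+ 2.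
Proof.
move=> f_convex f_diff x_flow fp s0 st.
have [|c /andP[sc ct] phiE] := @is_derive_MVT R
    (fun t => \sum_(j < m) (x t 0 j - p 0 j) ^+ 2)
    (fun t => 2 * \sum_(j < m) (x t 0 j - p 0 j) *
                  (- gradient f (x t)) 0 j) s t st.
  move=> c /andP[sc _]; apply: is_derive_sqdist.
  by apply: gradient_flow_is_derive => //; exact: lt_le_trans s0 sc.
have cp : 'D_(p - x c) f (x c) <= f p - f (x c).
  by apply: convex_derive_le => //; exact: diff_derivable.
(* Monotonicity trades the unknown mean value time [c] for the endpoint [t]. *)
have ftc : f (x t) <= f (x c).
  by apply: gradient_flow_nincr f_diff x_flow _ ct; exact: lt_le_trans s0 sc.
rewrite -[leRHS]opprB phiE -mulNr [leLHS]mulrC ler_wpM2r ?subr_ge0 //.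
rewrite -mulrN ler_pM2l //.
(* The sign of the flow is absorbed by reversing [x c - p] into [p - x c], the direction towards the
   minimizer. *)
have -> : - \sum_(j < m) (x c 0 j - p 0 j) * (- gradient f (x c)) 0 j =
    - 'D_(p - x c) f (x c).
  rewrite derive_gradient // -!sumrN; apply: eq_bigr => j _.
  by rewrite !mxE; ring.
lra.
Qed.

Theorem corollary2p4 (R : realType) (m : nat) (f : 'rV[R]_m -> R)
    (x : R -> 'rV[R]_m)
    (f_convex : convex_function [set: convex_lmodType 'rV[R]_m] f)
    (f_C1 : C1_function f)
    (f_min : has_minimizer f)
    (x_flow : gradient_flow f x) :
  t * (f (x t) - inf (range f)) @[t --> +oo] --> (0 : R).
Proof.
have [p fp] := f_min; have [f_diff _] := f_C1.
rewrite (@inf_range_minimizer _ _ _ _ fp).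
(* The factor [2^-1] cancels the 2 that comes from differentiating the square. *)
apply: (@cvg_mul_decrement R
  (fun t => 2^-1 * \sum_(j < m) (x t 0 j - p 0 j) ^+ 2)) => [t _|t _|s t s0 st].
- by rewrite mulr_ge0 // sumr_ge0 // => j _; exact: sqr_ge0.
- by rewrite subr_ge0.
have := @gradient_flow_sqdist _ _ _ _ _ _ _ f_convex f_diff x_flow fp s0 st; lra.
Qed.
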